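(* Let $\mathcal M$ be a bounded label. (a) The following conditions are equivalent. (i) If $\{S_i\}$ is a sequence of finite subsets of $\mathbb N$ with $\bigcup_iS_i$ infinite, there are only finitely many subsets $S$ of $\mathbb N$ such that eventually $S\cup S_i\in\mathrm{Supp}\,\mathcal M$. (ii) If $\{\ell^i\}$ is a sequence of distinct positive integers then there are only finitely many $\ell\in\mathbb N$ such that eventually $\{\ell,\ell^i\}\in\mathrm{Supp}\,\mathcal M$. (iii) The label is finitary, i.e. if $\{\mathbf r^i\}$ is a sequence of $\mathbb N$-vectors with $\bigcup_i\mathrm{supp}\,\mathbf r^i$ infinite, then $LIMINF\{\mathcal M-\mathbf r^i\}$ is finite. (iv) If $\{\mathbf r^i\}$ is a sequence of $\mathbb N$-vectors with $\bigcup_i\mathrm{supp}\,\mathbf r^i$ infinite and $\{\mathcal M-\mathbf r^i\}$ convergent, then $LIM\{\mathcal M-\mathbf r^i\}$ is finite. (v) If $\mathcal N\subset FIN(\mathbb N)$ is infinite then $\mathcal M-\mathcal N$ is finite, and there is no strictly increasing sequence in the collection $\{\mathcal M-\mathcal N:\mathcal N\text{ infinite}\}$ of finite labels. (vi) If $\{\mathbf r^i:i\in I\}$ is a net of $\mathbb N$-vectors which is not cofinal constant, and $\{\mathcal M-\mathbf r^i:i\in I\}$ is convergent, then $LIM\{\mathcal M-\mathbf r^i\}$ is finite. (b) If $\mathcal M$ is finitary then it is semi-simple. (c) If $\mathcal M$ is finitary, then the following conditions on a finite subset $\mathcal F$ of $\mathcal M$ are equivalent. (i) There exists a sequence $\{\mathbf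 r^i\}$ of $\mathbb N$-vectors with $\bigcup_i\mathrm{supp}\,\mathbf r^i$ infinite such that $LIM\{\mathcal M-\mathbf r^i\}=\mathcal F$. (ii) There exists a sequence $\{\mathbf r^i\}$ of distinct $\mathbb N$-vectors such that $LIM\{\mathcal M-\mathbf r^i\}=\mathcal F$. (iii) There is an infinite set $\mathcal N\subset FIN(\mathbb N)$ such that $\mathcal F=\mathcal M-\mathcal N_1$ for every infinite subset $\mathcal N_1$ of $\mathcal N$.
   Context: Write $\mathbb N=\{1,2,\dots\}$. An $\mathbb N$-vector is a function $\mathbf m:\mathbb N\to\{0,1,2,\dots\}$ with finite support $\mathrm{supp}\,\mathbf m$; $FIN(\mathbb N)$ is the additive monoid of all $\mathbb N$-vectors, with identity $\mathbf 0$ and the pointwise order. A label is a set $\mathcal M\subset FIN(\mathbb N)$ such that $\mathbf 0\le\mathbf m_1\le\mathbf m\in\mathcal M$ implies $\mathbf m_1\in\mathcal M$; $\mathrm{Supp}\,\mathcal M=\{\mathrm{supp}\,\mathbf m:\mathbf m\in\mathcal M\}$. $\mathcal M$ is bounded if $\sup_{\mathbf m\in\mathcal M}\mathbf m_\ell<\infty$ for each $\ell$. For $\mathbf r\in FIN(\mathbb N)$, $\mathcal M-\mathbf r=\{\mathbf w\in FIN(\mathbb N):\mathbf w+\mathbf r\in\mathcal M\}$, and for a nonempty set $\mathcal N\subset FIN(\mathbb N)$, $\mathcal M-\mathcal N=\bigcap_{\mathbf r\in\mathcal N}(\mathcal M-\mathbf r)$. For a sequence or net of labels, $LIMSUP\{\mathcal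 M^i\}=\bigcap_i\bigcup_{j\ge i}\mathcal M^j$, $LIMINF\{\mathcal M^i\}=\bigcup_i\bigcap_{j\ge i}\mathcal M^j$; the net is convergent (equivalently, converges in the space $\mathcal{LAB}$ of labels with the topology inherited from $\{0,1\}^{FIN(\mathbb N)}$) iff these coincide, and $LIM$ is then the common value. A label $\mathcal M$ is finitary if it is bounded and $LIMINF\{\mathcal M-\mathbf r^i\}$ is finite whenever $\{\mathbf r^i\}$ is a sequence of $\mathbb N$-vectors with $\bigcup_i\mathrm{supp}\,\mathbf r^i$ infinite. A net $\{\mathbf r^i:i\in I\}$ in $FIN(\mathbb N)$ is cofinal constant if for some $\mathbf r$ the set $\{i\in I:\mathbf r^i=\mathbf r\}$ is cofinal in $I$. $\Theta(\mathcal M)$ is the closure in $\mathcal{LAB}$ of $\{\mathcal M-\mathbf r:\mathbf r\in FIN(\mathbb N)\}$, on which each $P_{\mathbf r}:\mathcal N\mapsto\mathcal N-\mathbf r$ acts. $\mathcal E(\Theta(\mathcal M))$ is the closure of $\{P_{\mathbf r}|\Theta(\mathcal M):\mathbf r\in FIN(\mathbb N)\}$ in $\Theta(\mathcal M)^{\Theta(\mathcal M)}$ (pointwise convergence), and $\mathcal E_*(\Theta(\mathcal M))=\mathcal E(\Theta(\mathcal M))\setminus\{P_{\mathbf r}|\Theta(\mathcal M):\mathbf r\in FIN(\mathbb N)\}$. $\mathcal M$ is semi-simple if $Q(\mathcal M)$ is finite for every $Q\in\mathcal E_*(\Theta(\mathcal M))$. *)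

(* Defs.v *)
From HB Require Import structures.
From mathcomp Require Import all_boot all_order all_algebra.
From mathcomp Require Import finmap multiset.
From mathcomp Require Import all_classical all_reals all_analysis.

Set Implicit Arguments.
Unset Strict Implicit.
Unset Printing Implicit Defensive.

Local Open Scope classical_set_scope.

(* The positive integers {1, 2, ...}. *)
Definition posN := {n : nat | (0 < n)%N}.

(* A finitely supported function posN -> nat is a finite multiset on posN:
   [mset0] is the zero vector, [`+`]%mset the sum, [`<=`]%mset the pointwise
   order, and [finsupp] the support. *)
Definition FIN := {mset posN}%mset.

Definition supp (m : FIN) : set posN := [set` finsupp m].

Record label := Label {
  label_set :> set FIN;
  label_down : forall m1 m : FIN,
    (m1 `<=` m)%mset -> label_set m -> label_set m1 }.

Lemma label_inj : injective label_set.
Proof.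
move=> [A dA] [B dB] /= AB; rewrite -{}AB in dB *.
by congr Label; exact: Prop_irrelevance.
Qed.

HB.instance Definition _ := gen_eqMixin label.
HB.instance Definition _ := gen_choiceMixin label.

(* The embedding of the space of labels in {0,1}^FIN, which carries the
   product topology. *)
Definition indicator (M : label) : {ptws FIN -> bool} :=
  fun m => m \in (M : set FIN).

HB.instance Definition _ := Topological.copy label (initial_topology indicator).

Definition Supp (M : set FIN) : set (set posN) := [set supp m | m in M].

Definition bounded (M : set FIN) := forall l : posN,
  exists B : nat, forall m : FIN, M m -> (m l <= B)%N.

(* M - r and M - N; the latter is meaningful only for nonempty N. *)
Definition lsub (M : set FIN) (r : FIN) : set FIN :=
  [set w | M (w `+` r)%mset].

Definition lsubs (M : set FIN) (N : set FIN) : set FIN :=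
  \bigcap_(r in N) lsub M r.

Definition directed (I : Type) (le : I -> I -> Prop) :=
  [/\ [set: I] !=set0,
      forall i, le i i,
      forall i j k, le i j -> le j k -> le i k &
      forall i j, exists k, le i k /\ le j k].

Section Nets.
Variables (I : Type) (le : I -> I -> Prop).

Definition LIMSUP (M : I -> set FIN) : set FIN :=
  \bigcap_i \bigcup_(j in [set j | le i j]) M j.

Definition LIMINF (M : I -> set FIN) : set FIN :=
  \bigcup_i \bigcap_(j in [set j | le i j]) M j.

Definition convergent (M : I -> set FIN) := LIMSUP M = LIMINF M.

(* Only meaningful when M is convergent. *)
Definition LIM (M : I -> set FIN) : set FIN := LIMINF M.

Definition cofinal_constant (r : I -> FIN) :=
  exists r0, forall i, exists j, le i j /\ r j = r0.

End Nets.

Definition infinite_support (r : nat -> FIN) :=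
  infinite_set (\bigcup_i supp (r i)).

Definition finitary (M : set FIN) :=
  bounded M /\
  forall r : nat -> FIN, infinite_support r ->
    finite_set (LIMINF leq (fun i => lsub M (r i))).

Lemma lsub_down (M : label) (r m1 m : FIN) :
  (m1 `<=` m)%mset -> lsub M r m -> lsub M r m1.
Proof.
move=> /msubsetP le_m; apply: label_down; apply/msubsetP => l.
by rewrite !msetE2 leq_add2r.
Qed.

Definition Pmap (r : FIN) (M : label) : label := Label (@lsub_down M r).

Definition Theta (M : label) : set label := closure (range (Pmap^~ M)).

Lemma Pmap_continuous r : continuous (Pmap r).
Proof.
apply: (@continuous_comp_initial _ _ _ indicator) => N.
have FN : Filter (nbhs N) := nbhs_filter N.
apply/cvg_sup => m; move: N FN => + _.
apply: (@continuous_comp_initial {ptws FIN -> bool} label bool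
  (fun f => f m) (indicator \o Pmap r)) => N.
apply: (@continuous_comp _ _ _ indicator
  (fun f : {ptws FIN -> bool} => f (m `+` r)%mset)).
  exact: initial_continuous.
exact: proj_continuous.
Qed.

Lemma PmapD r s (M : label) : Pmap r (Pmap s M) = Pmap (r `+` s)%mset M.
Proof.
apply: label_inj; rewrite predeqE => m /=; rewrite /lsub /=.
suff -> : (m `+` r `+` s = m `+` (r `+` s))%mset by [].
by apply/msetP => l; rewrite !msetE2 addnA.
Qed.

Lemma Pmap_Theta (M : label) r : set_fun (Theta M) (Theta M) (Pmap r).
Proof.
move=> N TN U /Pmap_continuous /TN [_ [[s _ <-] Us]].
by exists (Pmap r (Pmap s M)); split => //; rewrite PmapD; exists (r `+` s)%mset.
Qed.

Lemma Theta_self (M : label) : Theta M M.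
Proof.
apply: subset_closure; exists mset0 => //; apply: label_inj.
rewrite predeqE => m /=; rewrite /lsub /=.
suff -> : msetD m mset0 = m by [].
by apply/msetP => l; rewrite msetE2 mset0E addn0.
Qed.

(* Pmap r restricted to a self-map of Theta M; the coercion of Theta M to a type
   yields the corresponding subspace of the space of labels. *)
Definition PTheta (M : label) (r : FIN) (N : Theta M) : Theta M :=
  SigSub (mem_set (@Pmap_Theta M r _ (set_valP N))).
Arguments PTheta : clear implicits.

Definition Enveloping (M : label) : set {ptws Theta M -> Theta M} :=
  closure (range (PTheta M : FIN -> {ptws Theta M -> Theta M})).
Arguments Enveloping : clear implicits.

Definition Enveloping_star (M : label) : set {ptws Theta M -> Theta M} :=
  Enveloping M `\` range (PTheta M).
Arguments Enveloping_star : clear implicits.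

(* M itself, as a point of Theta M. *)
Definition base_point (M : label) : Theta M :=
  SigSub (mem_set (@Theta_self M)).

Definition semi_simple (M : label) :=
  forall Q : {ptws Theta M -> Theta M}, Enveloping_star M Q ->
    finite_set (set_val (Q (base_point M)) : set FIN).

(* Main.v *)
Require Import Defs.
From mathcomp Require Import all_boot all_order all_algebra.
From mathcomp Require Import finmap multiset.
From mathcomp Require Import all_classical all_reals all_analysis.

Local Open Scope classical_set_scope.

(** The label [M] is bounded, so a subset of [M] is infinite exactly when the
    supports of its members cover infinitely many positions.  Hence an infinite
    [LIMINF] of the shifts [M - r i], being a bounded label, contains infinitely
    many unit vectors (Lemma [LIMINF_lsub_singletons]), and conversely.  A
    failure of any of the conditions of (a) therefore amounts to infinitely many
    positions [x] each of which is eventually compatible, inside [M], with the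
    members of one sequence.

    The conditions are compared through a common form,
    [finitary_on_distinct M]: for every sequence of distinct vectors,
    [LIMINF (M - r i)] is finite.  When this [LIMINF] is nonempty, almost all
    [r i] lie in [M], so distinctness forces the supports to have an infinite
    union; and since there are only countably many vectors, a diagonal argument
    ([convergent_subsequence]) yields a convergent subsequence, whose limit is at
    least as large as the original [LIMINF].  So the condition restricted to
    convergent sequences, as in (iv) and in the sequential case of (vi), already
    gives the common form ([finitary_on_distinct_of_convergent]).

    The common form gives (i) by sending [S_ i] to the unit vector at a fresh
    point of [S_ i] ([Supp_finite_of_distinct]), and gives (v) because an
    infinite [N], or a chain of sets [M - N_ i], is dominated by the [LIMINF]
    along distinct vectors [r i] taken in [N], resp. in [N_ i]
    ([lsubs_of_distinct]).  From (v) to (vi), the tails of a net that is not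
    cofinal constant take infinitely many values, so [LIMINF (M - r i)] is a
    directed union of finite sets [M - N] with [N] infinite; were the union
    infinite, it would contain a strictly increasing sequence of them
    ([net_LIMINF_finite]).  Finally (ii) gives (iii) by taking a fresh position
    in the supports of the [r i] ([finitary_of_pairs]).

    For (b), a point [Q] of the enveloping semigroup is a limit of maps [P_r].
    Index the pairs of a neighbourhood of [Q] and an [r] with [P_r] in it by
    reverse inclusion: this net converges to [Q], and it is not cofinal constant
    when [Q] is no [P_r] itself.  So [Q M] is contained in a finite [LIMINF].

    For (c), finiteness of [F] lets a tail of the sequence play the role of the
    set [N]: all its members contain [F] in their shift, while a vector that
    belongs to infinitely many of the shifts is in the [LIMSUP], which is [F].
    Conversely any injective enumeration of [N] has limit [F]. *)

(** * Selecting sequences from infinite sets *)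

(** Each choice only has to avoid the finitely many previous ones, so the list of
    values chosen so far is carried along in the recursion. *)
Lemma injective_selection {T : choiceType} {P : nat -> set T} :
  (forall n, infinite_set (P n)) ->
  exists l : nat -> T, injective l /\ forall n, P n (l n).
Proof.
move=> Pinf.
have /choice[h hP] (ns : nat * seq T) : exists x, P ns.1 x /\ x \notin ns.2.
  have /infinite_setN0[x [Px /= nx]] : infinite_set (P ns.1 `\` [set` ns.2]).
    by apply: infinite_setD => //; apply: finite_seq.
  by exists x; split => //; apply/negP.
pose L := fix L n := if n is k.+1 then h (k, L k) :: L k else [::].
exists (fun n => h (n, L n)); split; last by move=> n; case: (hP (n, L n)).
have hL m n : (m < n)%N -> h (m, L m) \in L n.
  elim: n => // n IHn; rewrite ltnS leq_eqVlt in_cons => /orP[/eqP -> |/IHn ->].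
    by rewrite eqxx.
  by rewrite orbT.
move=> m n e; have [mn|nm|//] := ltngtP m n.
  by have [_] := hP (n, L n); rewrite -e hL.
by have [_] := hP (m, L m); rewrite e hL.
Qed.

Lemma injective_sequence {T : choiceType} {N : set T} : infinite_set N ->
  exists r : nat -> T, injective r /\ forall i, N (r i).
Proof. by move=> Ninf; exact: injective_selection (fun=> Ninf). Qed.

Lemma infinite_injective_image {T U : Type} (f : T -> U) (A : set T) :
  injective f -> infinite_set A -> infinite_set (f @` A).
Proof.
move=> fI; apply: contra_not => /(finite_preimage (in2W fI)).
by apply: sub_finite_set => x Ax; exists x.
Qed.

Lemma infinite_from n : infinite_set [set j | leq n j].
Proof.
apply: (@sub_infinite_set _ ([set: nat] `\` `I_n)).
  by move=> j [_ /negP]; rewrite -leqNgt.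
by apply: infinite_setD; [exact: infinite_nat | exact: finite_II].
Qed.

(** Finitely many of the finite sets cover only finitely many points. *)
Lemma infinite_tail {T : Type} (S_ : nat -> set T) n :
  (forall i, finite_set (S_ i)) -> infinite_set (\bigcup_i S_ i) ->
  infinite_set (\bigcup_(i in [set i | leq n i]) S_ i).
Proof.
move=> Sfin; apply: contra_not => tail_fin.
apply: (@sub_finite_set _ _
  (\bigcup_(i in `I_n) S_ i `|` \bigcup_(i in [set i | leq n i]) S_ i)).
  by move=> x [i _ Six]; have [ni|ni] := leqP n i; [right|left]; exists i.
rewrite finite_setU; split => //.
by apply: bigcup_finite => // ; exact: finite_II.
Qed.

Lemma finite_subsets {T : choiceType} (A : set T) : finite_set A ->
  finite_set [set S | S `<=` A].
Proof.
move=> /finite_fsetP[X ->].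
apply: (sub_finite_set _ (finite_image (fun Y : {fset T} => [set` Y])
  (finite_fset (fpowerset X)))).
move=> S /= SX; have /finite_fsetP[Y eY] : finite_set S.
  exact: sub_finite_set SX (finite_fset X).
exists Y => //=; rewrite fpowersetE; apply/fsubsetP => x xY.
by apply: SX; rewrite eY.
Qed.

(** The point [l n] can be taken in the union of the [S_ i] with [n <= i], which
    is infinite.  The indices [f n] need not increase: [n <= f n] is enough for
    an eventual property of the [S_ i] to hold eventually along [f]. *)
Lemma spread_selection {T : choiceType} (S_ : nat -> set T) :
  (forall i, finite_set (S_ i)) -> infinite_set (\bigcup_i S_ i) ->
  exists f : nat -> nat, exists l : nat -> T,
    [/\ injective l, forall n, (n <= f n)%N & forall n, S_ (f n) (l n)].
Proof.
move=> Sfin Sinf.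
have [l [lI lS]] := injective_selection (fun n => infinite_tail S_ n Sfin Sinf).
have /choice[f fP] n : exists i, (n <= i)%N /\ S_ i (l n).
  by have [i ni Sil] := lS n; exists i.
by exists f, l; split => // n; case: (fP n).
Qed.

(** * Limits along directed sets *)
Lemma directed_leq : directed leq.
Proof.
split; [by exists 0%N|exact: leqnn|by move=> i j k; exact: leq_trans|].
by move=> i j; exists (maxn i j); rewrite leq_maxl leq_maxr.
Qed.

(** A finite set of eventual properties holds simultaneously from some index on,
    beyond any prescribed [i0]. *)
Lemma directed_finite_ub {I T : Type} {le : I -> I -> Prop} {A : set T}
    {P : T -> I -> Prop} (i0 : I) : directed le -> finite_set A ->
  (forall t i j, le i j -> P t i -> P t j) ->
  (forall t, A t -> exists i, P t i) ->
  exists u, le i0 u /\ forall t, A t -> P t u.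
Proof.
move=> [_ le_refl le_trans le_ub] /finite_setP[n].
elim: n A => [|n IHn] A.
  by rewrite II0 card_eq0 => /eqP -> _ _; exists i0; split.
move=> /eq_cardSP[t At An] Pmono Pex.
have [u [iu uP]] := IHn _ An Pmono (fun s As => Pex s As.1).
have [i Pti] := Pex t At; have [k [uk ik]] := le_ub u i.
exists k; split; first exact: le_trans iu uk.
move=> s As; have [->|st] := pselect (s = t); first exact: Pmono ik Pti.
by apply: Pmono uk _; apply: uP.
Qed.

Section LimitsAlongNets.
Context {I : Type} {le : I -> I -> Prop}.
Hypothesis dle : directed le.

Lemma LIMINF_sub_LIMSUP (A : I -> set FIN) : LIMINF le A `<=` LIMSUP le A.
Proof.
case: dle => _ _ _ ub m [i _ im] j _; have [k [ik jk]] := ub i j.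
by exists k => //; exact: im.
Qed.

Lemma convergent_to (A : I -> set FIN) (L : set FIN) :
  L `<=` LIMINF le A -> LIMSUP le A `<=` L ->
  convergent le A /\ LIM le A = L.
Proof.
move=> LA AL; have IS := LIMINF_sub_LIMSUP A.
have e : LIMINF le A = L by apply/seteqP; split => // m /IS /AL.
by split => //; rewrite /convergent e; apply/seteqP; split => // m /LA/IS.
Qed.

Lemma finite_sub_LIMINF (A : I -> set FIN) (F : set FIN) :
  finite_set F -> F `<=` LIMINF le A ->
  exists i, forall j, le i j -> F `<=` A j.
Proof.
move=> finF FA; have [[i0 _] _ le_trans _] := dle.
have [||i [_ iP]] := @directed_finite_ub _ _ le F
    (fun m i => forall j, le i j -> A j m) i0 dle finF.
- by move=> m i j ij iP k jk; apply: iP; exact: le_trans ij jk.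
- by move=> m /FA[i _ iP]; exists i.
by exists i => j ij m Fm; exact: iP.
Qed.

(** If a tail took finitely many values, each of them would be left for good
    after some index; past a common upper bound of these indices the net would
    have no value left. *)
Lemma net_tail_infinite (r : I -> FIN) (i : I) :
  ~ cofinal_constant le r -> infinite_set [set r j | j in [set j | le i j]].
Proof.
move=> ncst fin_tail; have [_ le_refl le_trans _] := dle.
have [||u [iu uP]] := @directed_finite_ub _ _ le _
    (fun s k => forall j, le k j -> r j <> s) i dle fin_tail.
- by move=> s k j kj kP l jl; apply: kP; exact: le_trans kj jl.
- move=> s _; apply: contrapT => nk; apply: ncst; exists s => k.
  by apply: contrapT => nj; apply: nk; exists k => j kj rj; apply: nj; exists j.
by apply: (uP (r u)); [exists u | exact: le_refl |].
Qed.

End LimitsAlongNets.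

Lemma subsequence_limits (A : nat -> set FIN) (f : nat -> nat) :
  (forall n, n <= f n)%N ->
  LIMINF leq A `<=` LIMINF leq (A \o f) /\ LIMSUP leq (A \o f) `<=` LIMSUP leq A.
Proof.
move=> fge; split => m.
  move=> [i _ im]; exists i => // j ij; apply: im.
  exact: leq_trans ij (fge j).
move=> im i _; have [j ij Am] := im i Logic.I.
by exists (f j) => //; exact: leq_trans ij (fge j).
Qed.

(** Sequential compactness of the space of subsets of the countable set [FIN], by
    diagonal extraction: the decreasing infinite sets of indices [B_ n] are such
    that membership of the [k]-th vector in [A i] does not depend on [i] in
    [B_ k.+1], and [f n] is a fresh point of [B_ n]. *)
Lemma convergent_subsequence (A : nat -> set FIN) :
  exists f : nat -> nat,
    [/\ injective f, forall n, (n <= f n)%N & convergent leq (A \o f)].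
Proof.
pose stays (B : set nat) m := infinite_set (B `&` [set i | A i m]).
pose refine B m := if `[< stays B m >] then B `&` [set i | A i m]
                   else B `\` [set i | A i m].
pose B_ := fix B_ n := if n is k.+1 then
    (if choice.unpickle k is Some m then refine (B_ k) m else B_ k)
  else [set: nat].
have refine_sub B m : refine B m `<=` B.
  by rewrite /refine; case: ifP => _ i [].
have refine_inf B m : infinite_set B -> infinite_set (refine B m).
  rewrite /refine; case: asboolP => // nstays Binf.
  have -> : B `\` [set i | A i m] = B `\` (B `&` [set i | A i m]).
    by rewrite setDIr setDv set0U.
  (* removing the finite set B `&` [i | A i m] leaves an infinite set *)
  by apply: infinite_setD => //; exact: contrapT.
have B_inf n : infinite_set (B_ n).
  elim: n => [|n IHn] /=; first exact: infinite_nat.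
  by case: choice.unpickle => // m; exact: refine_inf.
have B_dec k n : leq k n -> (B_ n `<=` B_ k)%classic.
  elim: n => [|n IHn]; first by rewrite leqn0 => /eqP ->.
  rewrite leq_eqVlt => /orP[/eqP -> //|]; rewrite ltnS => /IHn kn.
  apply: subset_trans kn => /=.
  by case: choice.unpickle => // m; exact: refine_sub.
have P_inf n : infinite_set (B_ n `&` [set i | leq n i]).
  apply: (@sub_infinite_set _ (B_ n `\` `I_n)).
    by move=> i [Bi /negP]; rewrite -leqNgt.
  by apply: infinite_setD => //; exact: finite_II.
have [f [fI fP]] := injective_selection P_inf.
exists f; split => [//|n|]; first by case: (fP n).
apply/seteqP; split; last exact: LIMINF_sub_LIMSUP directed_leq _.
move=> m /(_ (choice.pickle m).+1 Logic.I)[j kj Am].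
exists (choice.pickle m).+1 => // n kn /=.
have mem i : ((choice.pickle m).+1 <= i)%N -> refine (B_ (choice.pickle m)) m (f i).
  move=> ki; have [/(B_dec _ _ ki) + _] := fP i.
  by rewrite /= choice.pickleK.
have := mem j kj; have := mem n kn; rewrite /refine; case: asboolP => _.
  by case.
by move=> _ [_ /(_ Am)].
Qed.

(** * Supports of vectors *)

(** Vectors with support in a finite set [S] and all entries at most [b] are
    the functions from [S] to ['I_b.+1]. *)
Lemma bounded_finite (A : set FIN) : bounded A ->
  finite_set (\bigcup_(m in A) supp m) -> finite_set A.
Proof.
move=> bA /finite_fsetP[S eS]; have /choice[B BP] := bA.
pose b := (\max_(l <- S) B l)%N.
pose mset_of (f : {ffun S -> 'I_b.+1}) : FIN := [fsfun x : S => f x : nat].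
apply: (@sub_finite_set _ _ (range mset_of)); last exact: finite_image.
move=> m Am; exists [ffun x => inord (m (val x))] => //.
apply/msetP => l; rewrite /mset_of.
rewrite fsfun_ffun; case: insubP => [u _ ul|lS] /=.
  rewrite ffunE inordK ul // ltnS (leq_trans (BP l m Am)) //.
  by apply: leq_bigmax_seq => //; rewrite -ul; exact: valP.
apply/esym/mset_eq0P; rewrite -msuppE; apply: contra lS => lm.
by have /predeqP/(_ l)[] := eS; move=> + _; apply; exists m.
Qed.

Lemma suppP (m : FIN) l : supp m l <-> l \in m.
Proof. by rewrite /supp /= msuppE. Qed.

Lemma finite_supp (m : FIN) : finite_set (supp m).
Proof. exact: finite_fset. Qed.

Lemma msub_pair {m : FIN} {l l' : posN} : l != l' -> supp m l -> supp m l' ->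
  ([mset l] `+` [mset l'] `<=` m)%mset.
Proof.
move=> ll' /suppP lm /suppP l'm; apply/msubsetP => x; rewrite !msetE2 !msetnE.
have [->|xl] := eqVneq x l; first by rewrite (negPf ll') addn0 mset_gt0.
by have [->|//] := eqVneq x l'; rewrite mset_gt0.
Qed.

Lemma supp_pair (l l' : posN) : supp ([mset l] `+` [mset l'])%mset = [set l; l'].
Proof.
apply/predeqP => x; rewrite suppP in_msetD !in_mset1.
by split => [/orP[]/eqP ->|[]->]; rewrite ?eqxx ?orbT //; [left|right].
Qed.

(** * Shifts of a label *)
Section LabelShifts.
Variable M : label.

Lemma lsub_le {r r1 m m1 : FIN} : (r1 `<=` r)%mset -> (m1 `<=` m)%mset ->
  lsub M r m -> lsub M r1 m1.
Proof. by move=> le_r le_m; apply: label_down; exact: msetDSS. Qed.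

Lemma lsub_shift {r m : FIN} : lsub M r m -> label_set M r.
Proof.
by move=> /(lsub_le (msubset_refl r) (msub0set m)); rewrite /lsub /= mset0D.
Qed.

Lemma lsub_sub {r : FIN} : lsub M r `<=` M.
Proof.
by move=> m /(lsub_le (msub0set r) (msubset_refl m)); rewrite /lsub /= msetD0.
Qed.

Section Limit.
Context {I : Type} {le : I -> I -> Prop}.
Hypothesis le_refl : forall i, le i i.
Variable r : I -> FIN.
Let L := LIMINF le (fun i => lsub M (r i)).

Lemma LIMINF_lsub_sub : L `<=` M.
Proof. by move=> m [i _ /(_ i (le_refl i))]; exact: lsub_sub. Qed.

Lemma LIMINF_lsub_le (m m1 : FIN) : (m1 `<=` m)%mset -> L m -> L m1.
Proof.
move=> le_m [i _ im]; exists i => // j ij.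
exact: lsub_le (msubset_refl _) le_m (im j ij).
Qed.

(** [L] is a bounded label, so if it contained finitely many unit vectors, its
    members would have their supports in a fixed finite set. *)
Lemma LIMINF_lsub_singletons : bounded M -> infinite_set L ->
  infinite_set [set l | L [mset l]%mset].
Proof.
move=> bM; apply: contra_not => Lfin; apply: bounded_finite.
  by move=> l; have [B BP] := bM l; exists B => m /LIMINF_lsub_sub; exact: BP.
apply: sub_finite_set Lfin => l [m Lm /suppP lm] /=.
by apply: LIMINF_lsub_le Lm; rewrite msub1set.
Qed.

End Limit.

Lemma injective_infinite_support (r : nat -> FIN) i0 : bounded M -> injective r ->
  (forall i, (i0 <= i)%N -> label_set M (r i)) -> infinite_support r.
Proof.
move=> bM rI rM fin_supp.
apply: (infinite_injective_image r _ rI (infinite_from i0)).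
apply: bounded_finite.
  move=> l; have [B BP] := bM l; exists B => _ [i /= i0i <-].
  by apply: BP; exact: rM.
by apply: sub_finite_set fin_supp => l [_ [i /= i0i <-] il]; exists i.
Qed.

(** The common form of the six conditions of (a): it asks for distinct vectors
    where the definition of a finitary label asks for supports with an infinite
    union. *)
Definition finitary_on_distinct := forall r : nat -> FIN, injective r ->
  finite_set (LIMINF leq (fun i => lsub M (r i))).

(** A nonempty [LIMINF] puts almost all [r i] in [M], which makes the supports of
    any sequence of distinct [r (f n)] cover infinitely many positions; passing
    to a convergent subsequence can only enlarge the [LIMINF]. *)
Lemma finitary_on_distinct_of_convergent : bounded M ->
  (forall r : nat -> FIN, injective r -> infinite_support r ->
    convergent leq (fun i => lsub M (r i)) ->
    finite_set (LIM leq (fun i => lsub M (r i)))) ->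
  finitary_on_distinct.
Proof.
move=> bM finLIM r rI; apply: contrapT => Linf.
have [m [i0 _ i0m]] := infinite_setN0 Linf.
have [f [fI fge fcvg]] := convergent_subsequence (fun i => lsub M (r i)).
have [Lsub _] := subsequence_limits (fun i => lsub M (r i)) f fge.
apply: (sub_infinite_set Lsub Linf).
apply: (finLIM (r \o f)) => //; first exact: inj_comp rI fI.
apply: (@injective_infinite_support _ i0) => //; first exact: inj_comp rI fI.
by move=> i i0i; apply: (lsub_shift (i0m _ (leq_trans i0i (fge i)))).
Qed.

Lemma finitary_distinct : finitary M -> finitary_on_distinct.
Proof.
move=> [bM finM]; apply: finitary_on_distinct_of_convergent => // r _ rinf _.
exact: finM.
Qed.

(** If [x] as a unit vector is in the [LIMINF], then [x] is eventually compatible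
    with all of [r i], in particular with a position [l i] of its support. *)
Lemma finitary_of_pairs : bounded M ->
  (forall l_ : nat -> posN, injective l_ ->
     finite_set [set l : posN | \forall i \near \oo, Supp M [set l; l_ i]]) ->
  finitary M.
Proof.
move=> bM finM; split => // r rinf; apply: contrapT => Linf.
have [f [l [lI fge lP]]] :=
  spread_selection (supp \o r) (fun i => finite_supp (r i)) rinf.
apply: (LIMINF_lsub_singletons leqnn _ bM Linf).
apply: sub_finite_set (finM l lI) => x [i _ ix]; exists i => // j /= ij.
exists ([mset x] `+` [mset l j])%mset; last exact: supp_pair.
apply: (lsub_le _ (msubset_refl _) (ix (f j) _)).
  by rewrite msub1set -suppP; exact: lP.
exact: leq_trans ij (fge j).
Qed.

(** If infinitely many sets [S] were eventually compatible with [S_ i], their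
    union would be infinite, and every point of it, as a unit vector, would be in
    the [LIMINF] along the unit vectors at fresh points [l n] of the [S_ i]. *)
Lemma Supp_finite_of_distinct : finitary_on_distinct ->
  forall S_ : nat -> set posN, (forall i, finite_set (S_ i)) ->
    infinite_set (\bigcup_i S_ i) ->
    finite_set [set S : set posN | \forall i \near \oo, Supp M (S `|` S_ i)].
Proof.
move=> finM S_ Sfin Sinf; apply: contrapT => manyS.
have [f [l [lI fge lP]]] := spread_selection S_ Sfin Sinf.
set SS := [set S | _] in manyS.
have union_inf : infinite_set (\bigcup_(S in SS) S).
  apply: contra_not manyS => /finite_subsets; apply: sub_finite_set.
  by move=> S SSS x Sx; exists S.
pose r n : FIN := [mset l n]%mset.
have rI : injective r by move=> m n /(msetn_inj (ltn0Sn 0)); exact: lI.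
apply: (infinite_injective_image (fun x : posN => [mset x]%mset) _ _ union_inf).
  by apply: msetn_inj.
apply: sub_finite_set (finM r rI) => _ [x [S [N _ NS] Sx] <-].
(* A support does not see multiplicities: membership of the pair in M follows
   only when x and l n differ. *)
have [k kx] : exists k, forall n, (k <= n)%N -> l n != x.
  have [[k <-]|nx] := pselect (exists k, l k = x).
    by exists k.+1 => n kn; apply: contraTneq kn => /lI ->; rewrite ltnn.
  by exists 0%N => n _; apply/eqP => lx; apply: nx; exists n.
exists (maxn N k) => // n /=; rewrite geq_max => /andP[Nn kn].
have [m Mm em] := NS (f n) (leq_trans Nn (fge n)).
apply: label_down Mm; apply: msub_pair; rewrite 1?eq_sym ?kx // em.
  by left.
by right; exact: lP.
Qed.

Lemma lsubs_sub_LIMINF {N : set FIN} {r : nat -> FIN} : (forall i, N (r i)) ->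
  lsubs M N `<=` LIMINF leq (fun i => lsub M (r i)).
Proof. by move=> rN m Nm; exists 0%N => // i _; apply: Nm. Qed.

(** A strictly increasing chain [A i = M - N_ i] has an infinite union, but a
    sequence of distinct [r i] in [N_ i] satisfies [A j `<=` M - r i] as soon as
    [j <= i], so the union is contained in the [LIMINF]. *)
Lemma lsubs_of_distinct : finitary_on_distinct ->
  (forall N : set FIN, infinite_set N -> finite_set (lsubs M N)) /\
  ~ (exists A : nat -> set FIN,
      (forall i, [set lsubs M N | N in [set N | infinite_set N]] (A i)) /\
      (forall i, A i `<` A i.+1)).
Proof.
move=> finM; split=> [N /injective_sequence[r [rI rN]]|[A [AN Alt]]].
  exact: sub_finite_set (lsubs_sub_LIMINF rN) (finM r rI).
have /choice[N_ N_P] i : exists N, infinite_set N /\ lsubs M N = A i.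
  by have [N Ninf <-] := AN i; exists N.
have [r [rI rN]] := injective_selection (fun i => (N_P i).1).
have Amono i j : (i <= j)%N -> A i `<=` A j.
  elim: j => [|j IHj]; first by rewrite leqn0 => /eqP ->.
  rewrite leq_eqVlt => /orP[/eqP -> //|]; rewrite ltnS => /IHj ij.
  exact: subset_trans ij (properW (Alt j)).
have /choice[a aP] i : exists m, A i.+1 m /\ ~ A i m.
  by have [_ /nonsubset[m [? ?]]] := Alt i; exists m.
have aI : injective a.
  move=> i j e; have [ij|ji|//] := ltngtP i j.
    by case: (aP j).2; rewrite -e; apply: Amono ij _ (aP i).1.
  by case: (aP i).2; rewrite e; apply: Amono ji _ (aP j).1.
apply: (infinite_injective_image a _ aI infinite_nat).
apply: sub_finite_set (finM r rI) => _ [i _ <-].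
exists i.+1 => // j ij; have := Amono _ _ ij _ (aP i).1.
by rewrite -(N_P j).2; apply; exact: rN.
Qed.

(** The [LIMINF] is the directed union of the sets [M - tail i], and each of
    these is finite since the tails are infinite.  If the union is infinite, none
    of them is the largest one, so they contain a strictly increasing sequence. *)
Lemma net_LIMINF_finite :
  (forall N : set FIN, infinite_set N -> finite_set (lsubs M N)) ->
  ~ (exists A : nat -> set FIN,
      (forall i, [set lsubs M N | N in [set N | infinite_set N]] (A i)) /\
      (forall i, A i `<` A i.+1)) ->
  forall (I : Type) (le : I -> I -> Prop) (r : I -> FIN),
    directed le -> ~ cofinal_constant le r ->
    finite_set (LIMINF le (fun i => lsub M (r i))).
Proof.
move=> finN nochain I le r dle ncst; apply: contrapT => Linf; apply: nochain.
pose tail i : set FIN := r @` [set j | le i j].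
have [[i0 _] le_refl le_trans le_ub] := dle.
have tail_inf i : infinite_set (tail i) by exact: net_tail_infinite.
have /choice[next nextP] i :
    exists j, le i j /\ lsubs M (tail i) `<` lsubs M (tail j).
  have /infinite_setN0[m [[k _ km] nm]] :
      infinite_set (LIMINF le (fun i => lsub M (r i)) `\` lsubs M (tail i)).
    by apply: infinite_setD => //; apply: finN.
  have [j [ij kj]] := le_ub i k; exists j; split => //; split => [|jsub].
    by move=> w iw _ [n jn <-]; apply: iw; exists n => //; exact: le_trans jn.
  by apply: nm; apply: jsub => _ [n jn <-]; apply: km; exact: le_trans jn.
exists (fun n => lsubs M (tail (iter n next i0))); split => n; last exact: (nextP _).2.
by exists (tail (iter n next i0)) => //; exact: tail_inf.
Qed.

Lemma finitary_net : finitary M ->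
  forall (I : Type) (le : I -> I -> Prop) (r : I -> FIN),
    directed le -> ~ cofinal_constant le r ->
    finite_set (LIMINF le (fun i => lsub M (r i))).
Proof.
by move=> /finitary_distinct/lsubs_of_distinct[]; exact: net_LIMINF_finite.
Qed.
End LabelShifts.

Lemma injective_not_cofinal_constant (r : nat -> FIN) :
  injective r -> ~ cofinal_constant leq r.
Proof.
move=> rI [s sP]; have [i [_ ri]] := sP 0%N; have [j [ij rj]] := sP i.+1.
by move: ij; rewrite (rI j i) ?ltnn // ri.
Qed.

(** * Semi-simplicity *)

(** Membership of a fixed vector [m] in [Q N] is a locally constant function of
    [Q], as a composite of evaluations. *)
Lemma near_same_mem (M : label) (Q : {ptws Theta M -> Theta M}) (N : Theta M)
    (m : FIN) :
  nbhs Q [set Q' : {ptws Theta M -> Theta M} |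
    label_set (set_val (Q' N)) m <-> label_set (set_val (Q N)) m].
Proof.
have cont : continuous (fun Q' : {ptws Theta M -> Theta M} =>
    (indicator (set_val (Q' N)) : FIN -> bool) m).
  move=> P.
  apply: (@continuous_comp _ _ _ (fun Q' : {ptws Theta M -> Theta M} => Q' N)
     (fun x => (indicator (set_val x) : FIN -> bool) m)).
    exact: proj_continuous.
  apply: (@continuous_comp _ _ _ (set_val : Theta M -> label)
     (fun x => (indicator x : FIN -> bool) m)).
    exact: initial_continuous.
  apply: (@continuous_comp _ _ _ indicator (fun f : {ptws FIN -> bool} => f m)).
    exact: initial_continuous.
  exact: proj_continuous.
have : nbhs ((indicator (set_val (Q N)) : FIN -> bool) m)
  [set (indicator (set_val (Q N)) : FIN -> bool) m] by [].
move=> /(cont Q); apply: (@filterS _ _ (nbhs_filter Q)) => Q' /=.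
rewrite /indicator => e.
by split => /mem_set; [rewrite e|rewrite -e]; rewrite inE.
Qed.

(** The net below runs over all pairs of a neighbourhood of [Q] and a vector [s]
    with [P_s] in it.  A vector attained cofinally would have [P_s] in every
    neighbourhood of [Q], hence [P_s = Q] as labels are separated by their
    members. *)
Lemma semi_simple_of_finitary (M : label) : finitary M -> semi_simple M.
Proof.
move=> finM Q [clQ nQ]; pose P := PTheta M : FIN -> {ptws Theta M -> Theta M}.
pose I := {Us : set {ptws Theta M -> Theta M} * FIN | nbhs Q Us.1 /\ Us.1 (P Us.2)}.
pose le (i j : I) := ((sval j).1 `<=` (sval i).1)%classic.
pose r (i : I) : FIN := (sval i).2.
have index U : nbhs Q U -> exists i : I, (sval i).1 = U.
  move=> QU; have [_ [[s _ <-] Us]] := clQ U QU.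
  by exists (exist _ (U, s) (conj QU Us)).
have dle : directed le.
  split => [|i|i j k ij jk|i j]; first by have [i _] := index _ filterT; exists i.
  - exact: subset_refl.
  - exact: subset_trans jk ij.
  have [k ek] := index _ (filterI (svalP i).1 (svalP j).1).
  by exists k; rewrite /le ek; split => ? [].
apply: (@sub_finite_set _ _ (LIMINF le (fun i => lsub M (r i)))).
  move=> m Qm; have [i ei] := index _ (near_same_mem M Q (base_point M) m).
  exists i => // j ij; have := ij _ (svalP j).2; rewrite ei => -[_].
  by apply.
apply: finitary_net => // -[s sP]; apply: nQ; exists s => //.
apply/funext => N; apply/val_inj/label_inj/predeqP => m.
have [i ei] := index _ (near_same_mem M Q N m).
have [j [ij rj]] := sP i; have := ij _ (svalP j).2.
by rewrite ei -/(r j) rj.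
Qed.

(** * Finite limits *)
Lemma frequently_infinite (P : set nat) :
  (forall i, exists2 j, leq i j & P j) -> infinite_set P.
Proof.
move=> freqP finP.
have [||u [_ uP]] :=
  directed_finite_ub (P := fun t i => t < i)%N 0%N directed_leq finP.
- by move=> t i j ij ti; exact: leq_trans ti ij.
- by move=> t _; exists t.+1.
by have [j uj /uP] := freqP u; rewrite ltnNge uj.
Qed.

Section FiniteLimits.
Variables (M : label) (F : set FIN).

Definition limit_along (r : nat -> FIN) :=
  convergent leq (fun i => lsub M (r i)) /\ LIM leq (fun i => lsub M (r i)) = F.

Lemma limit_along_subsequence (r : nat -> FIN) (f : nat -> nat) :
  (forall n, (n <= f n)%N) -> limit_along r -> limit_along (r \o f).
Proof.
move=> fge [cvg_r limF].
have [infsub supsub] := subsequence_limits (fun i => lsub M (r i)) f fge.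
apply: (convergent_to directed_leq); first by rewrite -limF.
by apply: subset_trans supsub _; rewrite cvg_r -limF.
Qed.

(** Infinitely many positions occur in the supports, hence infinitely many
    vectors occur in the sequence, and a subsequence of distinct ones can be
    extracted. *)
Lemma distinct_limit (r : nat -> FIN) : infinite_support r -> limit_along r ->
  exists r' : nat -> FIN, injective r' /\ limit_along r'.
Proof.
move=> rinf limr.
have [||f [l [lI fge lP]]] := spread_selection (fun i => [set r i]).
- by move=> i; exact: finite_set1.
- apply: contra_not rinf; rewrite bigcup_imset1 => fin_r.
  rewrite -(bigcup_image setT r supp).
  by apply: bigcup_finite fin_r _ => m _; exact: finite_supp.
exists (r \o f); split; last exact: limit_along_subsequence.
by have <- : l = r \o f by exact/funext.
Qed.

(** [N] is a tail of the sequence along which [F] is contained in all shifts.  For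
    an infinite part [N1] of it, a vector in all the shifts by [N1] is in
    infinitely many shifts of the sequence, hence in the [LIMSUP]. *)
Lemma limit_to_set (r : nat -> FIN) : finite_set F -> injective r ->
  limit_along r ->
  exists N : set FIN, infinite_set N /\
    forall N1 : set FIN, infinite_set N1 -> N1 `<=` N -> F = lsubs M N1.
Proof.
move=> finF rI [cvg_r limF].
have [|i0 i0P] := finite_sub_LIMINF directed_leq (fun i => lsub M (r i)) F finF.
  by rewrite -limF.
exists (r @` [set i | leq i0 i]); split.
  exact: infinite_injective_image rI (infinite_from i0).
move=> N1 N1inf N1N; apply/seteqP; split => m.
  by move=> Fm s /N1N[i i0i <-]; exact: i0P.
move=> N1m; rewrite -limF /LIM -cvg_r => i _.
have /infinite_setN0[s [N1s nrs]] : infinite_set (N1 `\` (r @` `I_i)).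
  by apply: infinite_setD => //; apply: finite_image; exact: finite_II.
have [j _ rj] := N1N s N1s; exists j; last by have := N1m s N1s; rewrite -rj.
by rewrite /= leqNgt; apply/negP => ji; apply: nrs; exists j.
Qed.

(** At a first position the vectors exceed the bound of [M], so none of them is
    in [M]; adding unit vectors at varying positions makes the supports cover
    infinitely many positions. *)
Lemma exists_empty_limit : bounded M -> exists r : nat -> FIN,
  infinite_support r /\ forall i, lsub M (r i) = set0.
Proof.
move=> bM; pose l i : posN := exist _ i.+1 (ltn0Sn i).
have [B BP] := bM (l 0%N).
exists (fun i => msetn B.+1 (l 0%N) `+` [mset l i])%mset; split.
  apply: (@sub_infinite_set _ (range l)).
    by move=> _ [i _ <-]; exists i => //; apply/suppP; rewrite in_msetD mset11 orbT.
  by apply: infinite_injective_image infinite_nat => i j [].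
move=> i; apply/seteqP; split => // m /lsub_shift/BP.
by rewrite msetE2 msetnxx -ltnS addSn ltnS ltnNge leq_addr.
Qed.

(** An injective sequence in [N] has limit [F].  When [F] is nonempty, its members
    are in [M], so their supports have an infinite union by boundedness.  When [F]
    is empty, the supports of the members of [N] may all lie in a finite set,
    and another sequence with empty limit has to be used. *)
Lemma set_to_limit (N : set FIN) : bounded M -> infinite_set N ->
  (forall N1 : set FIN, infinite_set N1 -> N1 `<=` N -> F = lsubs M N1) ->
  exists r : nat -> FIN, infinite_support r /\ limit_along r.
Proof.
move=> bM Ninf NF; have [[m Fm]|F0] := pselect (F !=set0); last first.
  have [r [rinf r0]] := exists_empty_limit bM; exists r; split => //.
  apply: (convergent_to directed_leq) => [m Fm|m]; first by case: F0; exists m.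
  by move=> /(_ 0%N Logic.I)[j _]; rewrite r0.
have FN : F = lsubs M N by exact: NF.
have [r [rI rN]] := injective_sequence Ninf; exists r; split.
  apply: (injective_infinite_support M r 0 bM rI) => i _.
  by apply: (@lsub_shift M _ m); move: Fm; rewrite FN; apply; exact: rN.
apply: (convergent_to directed_leq).
  by rewrite FN; exact: lsubs_sub_LIMINF.
move=> w wsup; (* A vector w in infinitely many shifts is in M - N1 for the infinite set N1
   of the vectors r i that shift M to a set containing w. *)
rewrite (NF (r @` [set i | lsub M (r i) w])).
- by move=> _ [i iw <-].
- apply: infinite_injective_image rI _; apply: frequently_infinite => i.
  exact: wsup.
- by move=> _ [i _ <-].
Qed.

End FiniteLimits.

(** * The equivalences *)
Theorem proposition4p11 (M : label) (bM : bounded M) :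
  (* (a) *)
  [<-> (* (i) *)
       forall S_ : nat -> set posN, (forall i, finite_set (S_ i)) ->
         infinite_set (\bigcup_i S_ i) ->
         finite_set [set S : set posN |
           \forall i \near \oo, Supp M (S `|` S_ i)];
       (* (ii) *)
       forall l_ : nat -> posN, injective l_ ->
         finite_set [set l : posN |
           \forall i \near \oo, Supp M [set l; l_ i]];
       (* (iii) *)
       finitary M;
       (* (iv) *)
       forall r : nat -> FIN, infinite_support r ->
         convergent leq (fun i => lsub M (r i)) ->
         finite_set (LIM leq (fun i => lsub M (r i)));
       (* (v) *)
       (forall N : set FIN, infinite_set N -> finite_set (lsubs M N)) /\
       ~ (exists A : nat -> set FIN,
            (forall i, [set lsubs M N | N in [set N | infinite_set N]] (A i)) /\
            (forall i, A i `<` A i.+1));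
       (* (vi) *)
       forall (I : Type) (le : I -> I -> Prop) (r : I -> FIN),
         directed le -> ~ cofinal_constant le r ->
         convergent le (fun i => lsub M (r i)) ->
         finite_set (LIM le (fun i => lsub M (r i)))]
  /\
  (* (b) *)
  (finitary M -> semi_simple M)
  /\
  (* (c) *)
  (finitary M -> forall F : set FIN, finite_set F -> F `<=` M ->
   [<-> (* (i) *)
        exists r : nat -> FIN,
          [/\ infinite_support r,
              convergent leq (fun i => lsub M (r i)) &
              LIM leq (fun i => lsub M (r i)) = F];
        (* (ii) *)
        exists r : nat -> FIN,
          [/\ injective r,
              convergent leq (fun i => lsub M (r i)) &
              LIM leq (fun i => lsub M (r i)) = F];
        (* (iii) *)
        exists N : set FIN, infinite_set N /\
          forall N1 : set FIN, infinite_set N1 -> N1 `<=` N ->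
            F = lsubs M N1]).

Proof.
split; last split; last first.
- move=> finM F finF _; tfae.
  + move=> [r [rinf cvg_r limF]].
    have [r' [r'I [? ?]]] := distinct_limit M F r rinf (conj cvg_r limF).
    by exists r'.
  + by move=> [r [rI cvg_r limF]]; exact: (limit_to_set M F r finF rI).
  + move=> [N [Ninf NF]]; have [r [? [? ?]]] := set_to_limit M F N bM Ninf NF.
    by exists r.
- exact: semi_simple_of_finitary.
tfae.
- move=> finS l lI.
  have := finS (fun i => [set l i]) (fun i => finite_set1 (l i)).
  rewrite bigcup_imset1 => /(_ (infinite_injective_image l _ lI infinite_nat)).
  have set1I : injective (fun x : posN => [set x]).
    by move=> x y /predeqP/(_ x)[xy _]; exact: xy.
  by move=> /(finite_preimage (in2W set1I)).
- exact: finitary_of_pairs.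
- by move=> [_ finM] r rinf _; exact: finM.
- move=> finLIM; apply/lsubs_of_distinct.
  by apply: finitary_on_distinct_of_convergent => // r _; exact: finLIM.
- by move=> [finN nochain] I le r dle ncst _; exact: net_LIMINF_finite.
- move=> finNet; apply: Supp_finite_of_distinct.
  apply: finitary_on_distinct_of_convergent => // r rI _.
  apply: finNet => //; first exact: directed_leq.
  exact: injective_not_cofinal_constant.
Qed.
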